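(* Let $p>2$ be prime and let $1\leq k_1<\cdots<k_s$ be integers with $k_s>1$. Let $r=\lfloor \log_2(k_s)\rfloor+1$. Then $$\pi^*_{k_1,\ldots,k_s}(p)\ \big|\ p^{\operatorname{ord}_{2^r}(p)}-1,$$ where $\operatorname{ord}_n(m)$ denotes the multiplicative order of $m$ modulo $n$.
   Context: For integers $1\leq k_1<\cdots<k_s$ and $n\geq 1$, put $$S(\sigma_{n,[k_1,\ldots,k_s]})=\sum_{j=0}^n(-1)^{\binom{j}{k_1}+\cdots+\binom{j}{k_s}}\binom{n}{j}.$$ (For $n\ge k_s$ this is $\sum_{x\in\mathbb{F}_2^n}(-1)^{f(x)}$, where $f=\sigma_{n,k_1}+\cdots+\sigma_{n,k_s}$ is a sum of elementary symmetric polynomials over $\mathbb{F}_2$.) The integer sequence $\{S(\sigma_{n,[k_1,\ldots,k_s]})\}_{n\geq 1}$ satisfies a homogeneous linear recurrence with integer coefficients. When $k_s>1$ the sequence is not identically zero; let $x_n=a_1x_{n-1}+\cdots+a_dx_{n-d}$ be the minimal-order such recurrence with integer coefficients that it satisfies, let $\chi_{k_1,\ldots,k_s}(t)=t^d-a_1t^{d-1}-\cdots-a_d$ be its characteristic polynomial, and let $A(k_1,\ldots,k_s)$ be its $d\times d$ companion matrix. It is known that $\chi_{k_1,\ldots,k_s}(t)$ is a product of distinct factors from the list $t-2,\Phi_4(t-1),\Phi_8(t-1),\ldots,\Phi_{2^r}(t-1)$, where $r=\lfloor\log_2(k_s)\rfloor+1$ and $\Phi_m$ is the $m$-th cyclotomic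 polynomial, and that $\Phi_{2^r}(t-1)$ always occurs. Hence $\det A(k_1,\ldots,k_s)$ is, up to sign, a power of 2, and $A(k_1,\ldots,k_s)$ is invertible modulo every odd prime $p$. The weak Pisano period $\pi^*_{k_1,\ldots,k_s}(p)$ is the multiplicative order of $A(k_1,\ldots,k_s)$ modulo $p$, i.e. the least $N\ge1$ with $A(k_1,\ldots,k_s)^N\equiv I \pmod p$. *)

(* Defs.v *)
From mathcomp Require Import all_boot all_order all_algebra.
From mathcomp Require Import boolp.

Set Implicit Arguments.
Unset Strict Implicit.
Unset Printing Implicit Defensive.

Import GRing.Theory.
Local Open Scope ring_scope.

Definition expsum (ks : seq nat) (n : nat) : int :=
  \sum_(j < n.+1) (-1) ^+ (\sum_(k <- ks) 'C(j, k))%N * ('C(n, j))%:Z.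

(* The list a = [:: a_1; ...; a_d] encodes the recurrence
     x_n = a_1 x_(n-1) + ... + a_d x_(n-d).
   The sequence starts at index 1, so the equation is required exactly for
   n > d, and x 0 is never used. *)
Definition satisfies_recurrence (x : nat -> int) (a : seq int) : Prop :=
  forall n : nat, (size a < n)%N ->
    x n = \sum_(i < size a) a`_i * x (n - i.+1)%N.

Definition minimal_recurrence (x : nat -> int) (a : seq int) : Prop :=
  satisfies_recurrence x a /\
  forall b : seq int, satisfies_recurrence x b -> (size a <= size b)%N.

(* t^d - a_1 t^(d-1) - ... - a_d; a`_i is a_(i+1). *)
Definition recurrence_charpoly (a : seq int) : {poly int} :=
  'X^(size a) - \sum_(i < size a) a`_i *: 'X^(size a - i.+1)%N.

(* The value is 0 when no positive power of x is 1. *)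
Definition mult_order (R : pzRingType) (x : R) : nat :=
  if pselect (exists N, (0 < N)%N && (x ^+ N == 1)) is left ex
  then ex_minn ex else 0%N.

(* p is meant to be prime. *)
Definition weak_pisano (a : seq int) (p : nat) : nat :=
  mult_order (map_mx (fun z : int => z%:~R : 'F_p)
                     (companionmx (recurrence_charpoly a))).

(* m is taken modulo n; the encoding 'Z_n is the ring of integers modulo n
   only for n > 1. *)
Definition ord_mod (n m : nat) : nat := mult_order (m%:R : 'Z_n).

(* Main.v *)
Require Import Defs.
From HB Require Import structures.
From mathcomp Require Import all_boot all_order all_algebra.
From mathcomp Require boolp.

(** Let m = 2^r, so that every k in ks is below m. The signs
    (-1)^(sum of the C(j, k)) are m-periodic in j, because C(m, i) is even for
    0 < i < m. Passing from the signs to their binomial transform, expsum ks,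
    replaces the shift by the shift minus one; hence (X - 1)^m - 1 kills
    expsum ks from index 0 on. This polynomial has the simple root 0, so it is
    X P with P monic over the integers, and P kills expsum ks from index 1 on,
    which is the range on which recurrences are required.

    The polynomials killing a sequence form an ideal that is stable under
    division by nonzero integers. A minimal recurrence a has a characteristic
    polynomial chi in this ideal, and so does the primitive part of
    gcd(chi, P). By Gauss's lemma that primitive part divides the monic P over
    the integers, so it is itself monic and encodes a recurrence; minimality
    of a then forces it to have the degree of chi, and chi divides P
    ([minimal_charpoly_dvd]).

    It remains to work modulo p, with q = p^o and o the order of p modulo m, so
    that m divides q - 1. Then X P = (X - 1)^m - 1 divides
    (X - 1)^q - (X - 1), which by Frobenius is X^q - X = X (X^(q-1) - 1).
    Cancelling X shows that P, hence chi, divides X^(q-1) - 1 modulo p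
    ([dvdp_Xn_sub1]), and Cayley-Hamilton concludes. *)

Set Implicit Arguments.
Unset Strict Implicit.
Unset Printing Implicit Defensive.

Import GRing.Theory.
Local Open Scope ring_scope.

(** * The linear functional of an integer sequence *)

(** The umbral functional of x: the linear form on polynomials that sends 'X^n
    to x n. Shifts of x become multiplications by 'X. *)
Definition umbral (x : nat -> int) (f : {poly int}) : int :=
  \sum_(i < size f) f`_i * x i.

Lemma umbral_widen x (f : {poly int}) N : (size f <= N)%N -> umbral x f = \sum_(i < N) f`_i * x i.
Proof.
move=> leN; rewrite /umbral (big_ord_widen _ (fun i => f`_i * x i) leN).
rewrite big_mkcond; apply: eq_bigr => i _; case: ltnP => // h.
by rewrite nth_default ?mul0r.
Qed.

Lemma umbral_is_scalar x : scalar (umbral x).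
Proof.
move=> c f g; pose N := maxn (size f) (size g).
have lef : (size f <= N)%N by rewrite leq_maxl.
have leg : (size g <= N)%N by rewrite leq_maxr.
rewrite (umbral_widen x lef) (umbral_widen x leg) (@umbral_widen x _ N); last first.
  rewrite (leq_trans (size_polyD _ _)) // geq_max leg andbT.
  exact: leq_trans (size_scale_leq _ _) lef.
rewrite mulr_sumr -big_split; apply: eq_bigr => i _ /=.
by rewrite coefD coefZ mulrDl mulrA.
Qed.
HB.instance Definition _ x :=
  GRing.isLinear.Build int {poly int} int *%R (umbral x) (umbral_is_scalar x).

Lemma umbralXn x n : umbral x 'X^n = x n.
Proof.
rewrite /umbral size_polyXn big_ord_recr /= coefXn eqxx mul1r big1 ?add0r // => i _.
by rewrite coefXn ltn_eqF ?mul0r.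
Qed.

Lemma scalar_umbral (L : {scalar {poly int}}) f : L f = umbral (fun n => L 'X^n) f.
Proof.
rewrite -{1}[f]coefK poly_def linear_sum; apply: eq_bigr => i _.
by rewrite linearZ.
Qed.

Lemma umbral_mulXn x m f : umbral x ('X^m * f) = umbral (fun n => x (m + n)%N) f.
Proof.
rewrite -{1}[f]coefK poly_def mulr_sumr linear_sum; apply: eq_bigr => i _.
by rewrite -scalerAr linearZ -exprD /= umbralXn.
Qed.

(** The binomial transform is the change of variable X -> X + 1, since X^n
    becomes (X + 1)^n. *)
Lemma umbral_binomial x f :
  umbral x (f \Po ('X + 1)) =
  umbral (fun n => \sum_(j < n.+1) x j * ('C(n, j))%:Z) f.
Proof.
rewrite comp_polyE linear_sum; apply: eq_bigr => i _; rewrite linearZ /=.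
congr (_ * _); rewrite addrC exprDn linear_sum; apply: eq_bigr => j _.
by rewrite expr1n mul1r linearMn /= umbralXn -mulr_natr natz.
Qed.

Lemma umbral_periodic x m f : (forall n, x (n + m)%N = x n) ->
  umbral x (('X^m - 1) * f) = 0.
Proof.
move=> xm; rewrite mulrBl mul1r linearB /= umbral_mulXn; apply/eqP.
by rewrite subr_eq0; apply/eqP/eq_bigr => i _; rewrite addnC xm.
Qed.

(** * The ideal of polynomials annihilating a sequence *)

(** Asking for all multiples of f, rather than for the values at f * 'X^n only,
    makes it immediate that these polynomials form an ideal. *)
Definition annihilates (x : nat -> int) (f : {poly int}) : Prop :=
  forall g, umbral x (f * g) = 0.

(** The transform is killed by 'X * P from index 0 on, since 'X^m - 1 kills x;
    the factor 'X is one shift, so P kills the transform from index 1 on. *)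
Lemma annihilates_binomial_transform x m P :
  (forall n, x (n + m)%N = x n) -> 'X * P = ('X - 1) ^+ m - 1 ->
  annihilates
    (fun n => \sum_(j < n.+2) x j * ('C(n.+1, j))%:Z) P.
Proof.
move=> xm defP g.
rewrite -(umbral_mulXn (fun n => \sum_(j < n.+1) x j * ('C(n, j))%:Z) 1) expr1.
rewrite mulrA defP -umbral_binomial rmorphM /= rmorphB rmorphXn rmorphB /=.
by rewrite comp_polyX !rmorph1 addrK umbral_periodic.
Qed.

Lemma annihilates_comb x f g u v :
  annihilates x f -> annihilates x g -> annihilates x (u * f + v * g).
Proof.
move=> xf xg h; rewrite mulrDl linearD /=.
by rewrite [u * f]mulrC [v * g]mulrC -!mulrA xf xg addr0.
Qed.

Lemma annihilatesZ x c f : c != 0 -> annihilates x (c *: f) <-> annihilates x f.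
Proof.
move=> c0; split=> xf g; last by rewrite -scalerAl linearZ /= xf mulr0.
by apply/eqP; have /eqP := xf g; rewrite -scalerAl linearZ mulf_eq0 (negPf c0).
Qed.

(** Over the integers the Bezout relation only yields a nonzero multiple of the
    gcd, which is enough as the ideal is stable under division by nonzero
    integers. *)
Lemma annihilates_gcdp x f g :
  annihilates x f -> annihilates x g -> annihilates x (gcdp f g).
Proof.
move=> xf xg; have [[u v] /= /eqpP[[c d] /= /andP[c0 d0] e]] := Pdiv.Idomain.Bezoutp f g.
apply/(annihilatesZ _ _ d0); rewrite -e; apply/(annihilatesZ _ _ c0).
exact: annihilates_comb.
Qed.

(** * Recurrences and monic annihilators *)

Lemma coef_recurrence_charpoly (a : seq int) i : (i <= size a)%N ->
  (recurrence_charpoly a)`_i = if i == size a then 1 else - a`_(size a - i.+1).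
Proof.
rewrite /recurrence_charpoly coefB coefXn coef_sum => lei.
under eq_bigr do rewrite coefZ coefXn.
case: eqVneq lei => [-> _|ni lei].
  rewrite big1 ?subr0 // => j _; rewrite gtn_eqF ?mulr0 //.
  by rewrite ltn_subrL /= (leq_trans _ (ltn_ord j)).
have lti : (i < size a)%N by rewrite ltn_neqAle ni.
have k : (size a - i.+1 < size a)%N by rewrite ltn_subrL /= (leq_trans _ lti).
rewrite (bigD1 (Ordinal k)) //= subnSK // subKn // eqxx mulr1 big1 ?addr0 ?sub0r //.
move=> j nj; rewrite (_ : (i == _) = false) ?mulr0 //; apply: contraNF nj => /eqP e.
by rewrite -val_eqE /= e subnSK // subKn // ltnW.
Qed.

Lemma size_recurrence_charpoly (a : seq int) :
  size (recurrence_charpoly a) = (size a).+1.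
Proof.
rewrite /recurrence_charpoly size_polyDl size_polyXn // size_polyN ltnS.
apply: (leq_trans (size_sum _ _ _)); apply/bigmax_leqP => i _.
apply: leq_trans (size_scale_leq _ _) _; rewrite size_polyXn subnSK //.
exact: leq_subr.
Qed.

Lemma recurrence_charpoly_monic (a : seq int) : recurrence_charpoly a \is monic.
Proof.
by rewrite monicE lead_coefE size_recurrence_charpoly coef_recurrence_charpoly ?eqxx.
Qed.

Lemma monic_recurrence_charpoly (f : {poly int}) : f \is monic ->
  exists2 b, recurrence_charpoly b = f & size b = (size f).-1.
Proof.
move=> fm; pose d := (size f).-1.
have sf : size f = d.+1 by rewrite prednK // size_poly_gt0 monic_neq0.
exists (mkseq (fun i => - f`_(d - i.+1)) d); rewrite ?size_mkseq //.
apply/polyP => i; have [led|ltd] := leqP i d; last first.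
  by rewrite !nth_default ?size_recurrence_charpoly ?size_mkseq ?sf.
rewrite coef_recurrence_charpoly size_mkseq //; case: eqVneq => [->|ni].
  by move: fm; rewrite monicE lead_coefE => /eqP.
have lti : (i < d)%N by rewrite ltn_neqAle ni.
by rewrite nth_mkseq ?subnSK ?leq_subr // opprK subKn.
Qed.

(** The index shift matches the convention that recurrences involve x 1, x 2 and
    so on but never x 0. *)
Lemma annihilates_charpoly x (a : seq int) :
  satisfies_recurrence x a <->
  annihilates (fun n => x n.+1) (recurrence_charpoly a).
Proof.
have E n : umbral (fun n => x n.+1) ('X^n * recurrence_charpoly a) =
    x (n + size a).+1 - \sum_(i < size a) a`_i * x ((n + size a).+1 - i.+1)%N.
  rewrite umbral_mulXn linearB /= umbralXn linear_sum; congr (_ - _).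
  apply: eq_bigr => i _; rewrite linearZ /= umbralXn; congr (_ * x _).
  by rewrite addnBA // subSn // ltn_addl.
split=> [rec g | ann n ltn].
  rewrite mulrC -[g]coefK poly_def mulr_suml linear_sum big1 // => i _.
  rewrite -scalerAl linearZ /= E -rec ?subrr ?mulr0 //.
  by rewrite ltnS leq_addl.
apply/eqP; rewrite -subr_eq0; have /eqP := ann 'X^(n - (size a).+1).
by rewrite mulrC E -addnS subnK.
Qed.

(** Minimality is among integer recurrences only, that is, among monic
    annihilators. Comparing with the rational minimal polynomial is replaced by
    taking the gcd with a known monic annihilator P: the primitive part of the
    gcd divides P over the integers, so its leading coefficient is 1 and it
    competes with the characteristic polynomial. *)
Lemma minimal_charpoly_dvd x a P : minimal_recurrence x a -> P \is monic ->
  annihilates (fun n => x n.+1) P -> exists Q, P = recurrence_charpoly a * Q.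
Proof.
move=> [rec min] Pm annP; set f := recurrence_charpoly a.
have fm : f \is monic := recurrence_charpoly_monic a.
have annf : annihilates (fun n => x n.+1) f by apply/annihilates_charpoly.
have [Q defP] := dvdpP_int (dvdp_gcdr f P).
set g := gcdp f P in defP; set h := zprimitive g in defP.
have g0 : g != 0 by rewrite gcdp_eq0 negb_and monic_neq0.
have annh : annihilates (fun n => x n.+1) h.
  apply/(@annihilatesZ _ (zcontents g)); first by rewrite zcontents_eq0.
  by rewrite -zpolyEprim; apply: annihilates_gcdp.
have hm : h \is monic.
  have := sgz_lead_primitive g; rewrite g0 -/h monicE => sh.
  have /eqP: lead_coef h * lead_coef Q = 1 by rewrite -lead_coefM -defP; apply/eqP.
  (* A unit of the integers that is positive, as primitive parts are. *)
  rewrite mulrC => /eqP/intUnitRing.unitzPl; rewrite qualifE /=.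
  by case/pred2P => e; move: sh; rewrite e.
have [b defb sb] := monic_recurrence_charpoly hm.
have /min: satisfies_recurrence x b by apply/annihilates_charpoly; rewrite defb.
rewrite sb size_zprimitive => le.
have /eqP: size g = size f.
  apply/eqP; rewrite eqn_leq dvdp_leq ?monic_neq0 ?dvdp_gcdl //=.
  by rewrite size_recurrence_charpoly -[size g]prednK // size_poly_gt0.
rewrite (dvdp_size_eqp (dvdp_gcdl _ _)) => /eqp_dvdl eqgf.
have := dvdp_gcdr f P; rewrite eqgf -/f.
by move/Pdiv.IdomainMonic.dvdpP => /(_ fm) [q ->]; exists q; rewrite mulrC.
Qed.

(** * Reduction modulo p *)

(** 'X * P divides ('X - 1)^q - ('X - 1), which Frobenius identifies with
    'X^q - 'X; cancelling 'X avoids any discussion of the roots of P or of the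
    invertibility of 'X modulo P. *)
Lemma dvdp_Xn_sub1 p k m (P : {poly 'F_p}) : prime p -> (m %| p ^ k - 1)%N ->
  'X * P = ('X - 1) ^+ m - 1 -> P %| 'X^(p ^ k - 1) - 1.
Proof.
move=> p_pr /dvdnP[c mq] defP; set q := (p ^ k)%N in mq *.
have q0 : (0 < q)%N by rewrite expn_gt0 prime_gt0.
have charq : [pchar {poly 'F_p}].-nat q.
  rewrite /q pnatX pnatE // (rmorph_pchar (@polyC _)) //; exact: pchar_Fp.
have frob : 'X^q = ('X - 1) ^+ q + 1 :> {poly 'F_p}.
  by rewrite -{1}['X](subrK 1) exprDn_pchar // expr1n.
rewrite -(@dvdp_mul2l _ 'X) ?polyX_eq0 // mulrBr mulr1 -exprS subn1 prednK //.
have -> : 'X^q - 'X = ('X - 1) * (('X - 1) ^+ q.-1 - 1) :> {poly 'F_p}.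
  by rewrite mulrBr mulr1 -exprS prednK // frob opprB addrA.
by rewrite -subn1 mq defP mulnC exprM dvdp_mull // [_ ^+ c - 1]subrX1 dvdp_mulr.
Qed.

(** For n = 0, which Cayley-Hamilton for nontrivial matrix rings does not cover,
    all matrices are equal. *)
Lemma char_poly_dvd_expr (F : fieldType) n (B : 'M[F]_n) N :
  char_poly B %| 'X^N - 1 -> B ^+ N = 1.
Proof.
case: n B => [|n] B; first by move=> _; rewrite [LHS]flatmx0 [RHS]flatmx0.
case/dvdpP => Q /(congr1 (horner_mx B)); rewrite rmorphM /= Cayley_Hamilton mulr0.
rewrite rmorphB rmorphXn rmorph1 /= horner_mx_X => /eqP.
by rewrite subr_eq0 => /eqP.
Qed.

(** * Multiplicative orders *)

(** When x has no positive power equal to 1, the order is 0 and the identity is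
    x ^+ 0 = 1. *)
Lemma expr_mult_order (R : pzRingType) (x : R) : x ^+ mult_order x = 1.
Proof.
by rewrite /mult_order; case: boolp.pselect => // ex; case: ex_minnP => N /andP[_ /eqP].
Qed.

Lemma mult_order_dvd (R : pzRingType) (x : R) N : x ^+ N = 1 -> (mult_order x %| N)%N.
Proof.
move=> xN; rewrite /mult_order; case: boolp.pselect => [ex | nex]; last first.
  by have [-> //|N0] := posnP N; case: nex; exists N; rewrite N0 xN eqxx.
case: ex_minnP => o /andP[o0 /eqP xo] min_o; rewrite /dvdn; case: posnP => // m0.
have : (o <= N %% o)%N.
  apply: min_o; rewrite m0 /=; apply/eqP.
  by move: xN; rewrite {1}(divn_eq N o) exprD mulnC exprM xo expr1n mul1r.
by rewrite leqNgt ltn_pmod.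
Qed.

Lemma ord_mod_dvd n p : (1 < n)%N -> (0 < p)%N -> (n %| p ^ ord_mod n p - 1)%N.
Proof.
move=> n1 p0; rewrite -eqn_mod_dvd ?expn_gt0 ?p0 //; apply/eqP.
have := expr_mult_order (p%:R : 'Z_n); rewrite -/(ord_mod n p) -natrX => h.
by rewrite -!val_Zp_nat // h.
Qed.

(** * Periodicity of the signs and an annihilator of expsum *)

(** From i C(2^r, i) = 2^r C(2^r - 1, i - 1): if C(2^r, i) were odd, 2^r would
    divide i. *)
Lemma even_bin_expn2 r i : (0 < i < 2 ^ r)%N -> ~~ odd 'C(2 ^ r, i).
Proof.
case: i => // i /= lti; apply/negP => oddC.
have := mul_bin_diag (2 ^ r) i => /(congr1 (dvdn (2 ^ r))).
rewrite dvdn_mulr // mulnC Gauss_dvdr; last by rewrite coprimeXl // coprime2n.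
by move=> /esym /dvdn_leq => /(_ isT); rewrite leqNgt lti.
Qed.

(** In Vandermonde's expansion of C(2^r + j, k), every term but the one
    taking nothing from 2^r has an even factor. *)
Lemma odd_bin_periodic r j k : (k < 2 ^ r)%N -> odd 'C(j + 2 ^ r, k) = odd 'C(j, k).
Proof.
move=> ltk; rewrite addnC -binomial.Vandermonde big_ord_recl bin0 mul1n subn0 oddD.
rewrite (_ : odd (\sum_(i < k) _) = false) ?addbF //.
apply: (big_ind (fun n => odd n = false)) => // [m n | i _].
  by rewrite oddD => -> ->.
rewrite oddM (negPf (even_bin_expn2 _)) //= /bump /= add1n.
by rewrite (leq_ltn_trans _ ltk).
Qed.

Lemma sign_periodic ks r j : all (fun k => k < 2 ^ r)%N ks ->
  (-1) ^+ (\sum_(k <- ks) 'C(j + 2 ^ r, k))%N = (-1) ^+ (\sum_(k <- ks) 'C(j, k))%N :> int.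
Proof.
move=> ltks; rewrite -signr_odd -[RHS]signr_odd; congr (_ ^+ nat_of_bool _).
elim: ks ltks => [|k ks IH] /=; first by rewrite !big_nil.
by case/andP => ltk /IH e; rewrite !big_cons !oddD e odd_bin_periodic.
Qed.

Lemma annihilates_expsum ks r P : all (fun k => k < 2 ^ r)%N ks ->
  'X * P = ('X - 1) ^+ (2 ^ r) - 1 -> annihilates (fun n => expsum ks n.+1) P.
Proof.
move=> ltks.
exact: (@annihilates_binomial_transform
          (fun j => (-1) ^+ (\sum_(k <- ks) 'C(j, k))%N) _ _
          (fun j => sign_periodic j ltks)).
Qed.

(** For m = 2^r with r > 0, this P is (X - 2) times the product of the Phi_(2^i)(X - 1) for
    2 <= i <= r. *)
Lemma shifted_power_factor m : ~~ odd m -> (0 < m)%N ->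
  exists2 P : {poly int}, P \is monic & 'X * P = ('X - 1) ^+ m - 1.
Proof.
move=> evm m0.
have [P defP] : exists P : {poly int}, ('X - 1) ^+ m - 1 = P * ('X - 0%:P).
  apply/factor_theorem; rewrite /root !hornerE.
  by rewrite -signr_odd (negPf evm) subrr.
rewrite subr0 mulrC in defP; exists P => //.
have: ('X - 1) ^+ m - 1 \is @monic int.
  rewrite monicE lead_coefDl; first by rewrite -monicE monic_exp ?monicXsubC.
  by rewrite size_polyN size_poly1 size_exp_XsubC.
by rewrite defP monicMl ?monicX.
Qed.

Lemma sorted_last_max ks k : sorted ltn ks -> k \in ks -> (k <= last 0%N ks)%N.
Proof.
move=> srt /(nthP 0%N)[i lti <-]; rewrite -nth_last.
have s0 : (0 < size ks)%N by apply: leq_ltn_trans lti.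
have := sorted_leq_nth leq_trans leqnn 0%N (sub_sorted (fun x y => @ltnW x y) srt).
by apply; rewrite ?inE ?prednK // -ltnS prednK.
Qed.

Local Close Scope ring_scope.

Theorem theorem4p1 (p : nat) (ks : seq nat) (a : seq int)
  (p_prime : prime p) (p_gt2 : 2 < p)
  (ks_ge1 : all (fun k => 1 <= k) ks) (ks_incr : sorted ltn ks)
  (ks_last : 1 < last 0 ks)
  (a_min : minimal_recurrence (expsum ks) a) :
  let r := (trunc_log 2 (last 0 ks)).+1 in
  weak_pisano a p %| p ^ ord_mod (2 ^ r) p - 1.
Proof.
cbv zeta; set r := (trunc_log _ _).+1; have gt_r k : k \in ks -> k < 2 ^ r.
  by move/(sorted_last_max ks_incr)/leq_ltn_trans; apply; apply: trunc_log_ltn.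
have [||P P_monic defP] := shifted_power_factor (m := 2 ^ r).
- by rewrite oddX.
- by rewrite expn_gt0.
have annP := annihilates_expsum (introT allP gt_r) defP.
have [Q defQ] := minimal_charpoly_dvd a_min P_monic annP.
apply/mult_order_dvd/char_poly_dvd_expr.
rewrite -map_char_poly companionmxK ?recurrence_charpoly_monic //.
apply: (@dvdp_trans _ (map_poly intr P)).
  by rewrite defQ rmorphM dvdp_mulr.
apply: (dvdp_Xn_sub1 (m := 2 ^ r)) => //.
  by apply: ord_mod_dvd; rewrite ?prime_gt0 // (ltn_exp2l 0).
move/(congr1 (map_poly (intr : int -> 'F_p))): defP.
by rewrite rmorphM rmorphB rmorphXn rmorphB rmorph1 /= map_polyX.
Qed.
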